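(* For intersecting families of bottomless rectangles, $m_k^*\le 3k$. That is, for every positive integer $k$, every finite intersecting family $\mathcal{F}$ of bottomless rectangles can be $k$-coloured so that every point of $\mathbb{R}^2$ covered by at least $3k$ rectangles of $\mathcal{F}$ is covered by rectangles of all $k$ colours.
   Context: A (closed) bottomless rectangle is a subset of $\mathbb{R}^2$ of the form $\{(x,y): l\le x\le r,\ y\le t\}$, denoted by its parameters $(l,r,t)$. A family of bottomless rectangles is intersecting if any two of its members intersect. For a class of families, $m_k^*$ is the smallest number $m$ such that every finite family in the class can be $k$-coloured so that every point covered by at least $m$ members of the family is covered by members of all $k$ colours. *)

(* Defs.v *)
From mathcomp Require Import all_boot all_order all_algebra.
From mathcomp Require Import boolp classical_sets reals.

Set Implicit Arguments.
Unset Strict Implicit.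
Unset Printing Implicit Defensive.

Import Order.TTheory GRing.Theory Num.Theory.

Local Open Scope classical_set_scope.
Local Open Scope ring_scope.

Definition bottomless_rectangle (R : realType) (l r t : R) : set (R * R) :=
  [set p | l <= p.1 <= r /\ p.2 <= t].

Definition is_bottomless_rectangle (R : realType) (A : set (R * R)) : Prop :=
  exists l r t : R, A = bottomless_rectangle l r t.

(* A finite family of subsets of T is a map F : I -> set T with I : finType;
   repeated members are allowed and are counted and coloured separately. *)

Definition intersecting (T : Type) (I : finType) (F : I -> set T) : Prop :=
  forall i j : I, i != j -> F i `&` F j !=set0.

Definition cover_number (T : Type) (I : finType) (F : I -> set T) (p : T) : nat :=
  #|[pred i : I | p \in F i]|.

Definition polychromatic_from (T : Type) (I : finType) (F : I -> set T)
    (k m : nat) (c : I -> 'I_k) : Prop :=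
  forall p : T, (m <= cover_number F p)%N ->
  forall a : 'I_k, exists2 i : I, c i = a & F i p.

Definition family_class (T : Type) := forall I : finType, (I -> set T) -> Prop.

Definition colourable_from (T : Type) (C : family_class T) (k m : nat) : Prop :=
  forall (I : finType) (F : I -> set T), C I F ->
  exists c : I -> 'I_k, polychromatic_from F m c.

(* m_k^* need not exist for an arbitrary class, so it is given as a relation:
   m is the value of m_k^* for the class C. *)
Definition is_mstar (T : Type) (C : family_class T) (k m : nat) : Prop :=
  colourable_from C k m /\
  forall m' : nat, colourable_from C k m' -> (m <= m')%N.

Definition intersecting_bottomless (R : realType) : family_class (R * R)%type :=
  fun I F => (forall i : I, is_bottomless_rectangle (F i)) /\ intersecting F.

(* Main.v *)
Require Import Defs.
From mathcomp Require Import all_boot all_order all_algebra.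
From mathcomp Require Import boolp classical_sets reals.
From mathcomp Require Import fintype finset.

(** Let [l i], [r i], [t i] be the parameters of the [i]-th rectangle.  Since
    the rectangles meet pairwise, [l i <= r j] for all [i != j], so for a point
    [(x, y)] one of the two horizontal conditions is automatic: either every
    [l i] is at most [x], or some [l j] exceeds [x] and then every [i] with
    [l i <= x] has [x < r i].  Hence the rectangles covering a point are those
    with [t i >= y] and [key i <= z], where [key] is one of the two functions
    [l] and [- r]: a half-line for one of two orders, inside a superlevel set
    of [t] (lemma [cover_halfline]).

    For such sets the bound is even [2 * k].  Delete the rectangles one by one
    by increasing [t], as long as at least [2 * k] remain, and follow the window
    of each order: its first [2 * k] remaining members.  A deletion removes a member from the windows but never
    pushes a surviving one out.  For every pair (order, colour), reserve one
    member of the window of that order for that colour, distinct pairs reserving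
    distinct members.  When a reserved rectangle is deleted, the other pairs
    hold at most [2 * k - 1] members, so its window still has a free member
    to reserve instead.  A reserved rectangle stays reserved until it is
    deleted, so it belongs to one pair only and can be given the colour of that
    pair for good.  At each stage each window thus shows every colour
    (lemmas [slot_assignment] and [polychromatic_halflines]).

    Deleting by increasing [t] is what makes this work: a rectangle leaves both
    windows at the same moment.  In the opposite direction it would leave the
    two windows at different moments, and its colour could clog the second. *)

Set Implicit Arguments.
Unset Strict Implicit.
Unset Printing Implicit Defensive.

Import Order.TTheory GRing.Theory Num.Theory.

(** * Distinct representatives *)

(** When every set has at least as many members as there are indices, distinct
    representatives can be chosen greedily, so any partial choice extends. *)
Lemma sdr_extend (I J : finType) (F : J -> {set I}) (D : {set J}) (f : J -> I) :
  (forall j, #|J| <= #|F j|) ->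
  {in D &, injective f} -> (forall j, j \in D -> f j \in F j) ->
  exists f' : J -> I,
    [/\ injective f', forall j, f' j \in F j & {in D, f' =1 f}].
Proof.
move=> Fbig; have [n] := ubnP #|~: D|.
elim: n => // n IH in D f *; rewrite ltnS => leDn f_inj fF.
have [DT|[j]] := set_0Vmem (~: D).
  have inD j : j \in D by rewrite -[D]setCK DT setC0 inE.
  by exists f; split=> // [i j|j]; [exact: f_inj | exact: fF].
rewrite inE => jD.
have /subsetPn[q qF qD] : ~~ (F j \subset f @: D).
  apply/negP => /subset_leq_card/(leq_trans (Fbig j)).
  apply/negP; rewrite -ltnNge (leq_ltn_trans (leq_imset_card _ _)) //.
  by rewrite -cardsT proper_card // properT; apply: contraNneq jD => ->; rewrite inE.
pose g i := if i == j then q else f i.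
have gD i : i \in D -> g i = f i.
  by rewrite /g; case: eqP => // ->; rewrite (negPf jD).
have fq i : i \in D -> f i != q.
  by move=> iD; apply: contraNneq qD => <-; exact: imset_f.
have gj : g j = q by rewrite /g eqxx.
have [||i|f' [f'_inj f'F f'g]] := IH (j |: D) g.
- apply: leq_trans leDn; apply: proper_card.
  by rewrite properC properE subsetUr /= subUset sub1set (negPf jD).
- move=> a b; rewrite !inE => /predU1P[->|aD] /predU1P[->|bD] //.
  + by rewrite gj gD // => /esym/eqP; rewrite (negPf (fq _ bD)).
  + by rewrite gj gD // => /eqP; rewrite (negPf (fq _ aD)).
  + by rewrite !gD //; exact: f_inj.
- by rewrite !inE => /predU1P[->|iD]; [rewrite gj | rewrite gD // fF].
exists f'; split=> // i iD; rewrite f'g ?gD //.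
by rewrite !inE iD orbT.
Qed.

(** * Assigning the members to slots *)

(** A member is to be given one slot for good; a slot [j] must show in [W j S]
    for each superlevel set [S] of the height [h].  Slots will be the pairs
    (order, colour). *)
Section SlotAssignment.
Variables (disp : Order.disp_t) (V : orderType disp) (I J : finType).
Variables (h : I -> V) (W : J -> {set I} -> {set I}).

Definition superlevel (S : {set I}) (y : V) : {set I} :=
  [set i in S | (y <= h i)%O].

Lemma superlevel_sub S y : superlevel S y \subset S.
Proof. by apply/subsetP=> i; rewrite inE => /andP[]. Qed.

Hypothesis W_sub : forall j S, W j S \subset S.
Hypothesis W_big : forall j (S : {set I}), #|J| <= #|S| -> #|J| <= #|W j S|.
Hypothesis W_del : forall j S p, W j S :\ p \subset W j (S :\ p).

(** Heights may tie, so [S] without one lowest member [p] need not be a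
    superlevel set of [S]; the induction on [S] only needs that deleting [p]
    loses no superlevel set other than [S] itself. *)
Lemma superlevel_del (S : {set I}) p y : p \in S ->
    (forall i, i \in S -> (h p <= h i)%O) ->
  superlevel S y = S \/
  p \notin superlevel S y /\ superlevel S y = superlevel (S :\ p) y.
Proof.
move=> pS pmin; have [yp|py] := leP y (h p); [left|right].
  by apply/setP=> i; rewrite inE; case: (boolP (i \in S)) => //= /pmin /(le_trans yp).
split; first by rewrite inE pS leNgt py.
apply/setP=> i; rewrite !inE; case: eqP => //= ->.
by rewrite pS leNgt py.
Qed.

(** [rep] is the current reservation; prescribing the values of the assignment
    on it is what lets the assignment found for [S :\ p] be kept when [p] is put
    back. *)
Lemma slot_assignment_from (S : {set I}) (rep : J -> I) (j0 : J) :
    injective rep -> (forall j, rep j \in W j S) ->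
  exists g : I -> J, cancel rep g /\
    forall y, #|J| <= #|superlevel S y| ->
    forall j, exists2 i, g i = j & i \in W j (superlevel S y).
Proof.
have [n] := ubnP #|S|; elim: n => // n IH in S rep *.
rewrite ltnS => leSn rep_inj repW.
have i0S : rep j0 \in S by exact: subsetP (W_sub j0 S) _ (repW j0).
pose p := [arg min_(i < rep j0 in S) h i]%O.
have [pS pmin] : p \in S /\ forall i, i \in S -> (h p <= h i)%O.
  by rewrite /p; case: arg_minP.
pose extend (g' : I -> J) i := if [pick j | rep j == i] is Some j then j else g' i.
have extendK g' : cancel rep (extend g').
  move=> j; rewrite /extend; case: pickP => [i /eqP/rep_inj//|/(_ j)].
  by rewrite eqxx.
have [small|big] := ltnP #|S :\ p| #|J|.
  exists (extend (fun=> j0)); split=> // y.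
  have [-> _ j|[_ ->]] := superlevel_del y pS pmin.
    by exists (rep j); rewrite ?extendK.
  move=> /leq_trans/(_ (subset_leq_card (superlevel_sub _ _))).
  by move=> /leq_ltn_trans/(_ small); rewrite ltnn.
have [| |j|rep' [rep'_inj rep'W rep'E]] :=
    @sdr_extend I J (fun j => W j (S :\ p)) [set j | rep j != p] rep.
- by move=> j; exact: W_big.
- by move=> i j _ _; exact: rep_inj.
- by rewrite inE => jp; apply: (subsetP (W_del j S p)); rewrite !inE jp repW.
have [|g' [g'K g'W]] := IH (S :\ p) rep' _ rep'_inj rep'W.
  by apply: leq_trans leSn; rewrite [X in _ < X](cardsD1 p) pS.
exists (extend g'); split=> // y.
have [-> _ j|[pSy ->]] := superlevel_del y pS pmin.
  by exists (rep j); rewrite ?extendK.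
move=> /g'W gW j; have [i gij iW] := gW j; exists i => //.
rewrite /extend; case: pickP => // j' /eqP rep_j'.
(* a surviving reserved member kept its slot, so both assignments agree on it *)
rewrite -gij -rep_j' -[in RHS](rep'E j') ?g'K // inE rep_j'.
have := subsetP (W_sub _ _) _ iW; rewrite !inE => /andP[/andP[ip _] _].
exact: ip.
Qed.

Lemma slot_assignment (j0 : J) :
  exists g : I -> J, forall y, #|J| <= #|superlevel [set: I] y| ->
    forall j, exists2 i, g i = j & i \in W j (superlevel [set: I] y).
Proof.
have [small|big] := ltnP #|[set: I]| #|J|.
  exists (fun=> j0) => y /leq_trans/(_ (subset_leq_card (subsetT _))).
  by move=> /leq_ltn_trans/(_ small); rewrite ltnn.
have /card_gt0P[i0 _] : 0 < #|[set: I]|.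
  by apply: leq_trans big; apply/card_gt0P; exists j0.
have [|i j|j|rep [rep_inj repW _]] :=
    @sdr_extend I J (fun j => W j [set: I]) set0 (fun=> i0).
- by move=> j; exact: W_big.
- by rewrite inE.
- by rewrite inE.
by have [g [_ gW]] := slot_assignment_from j0 rep_inj repW; exists g.
Qed.

End SlotAssignment.

(** * The first members of an order *)

Section Window.
Variables (disp : Order.disp_t) (V : orderType disp) (I : finType).
Variables (key : I -> V) (m : nat).

(** Members tied with the [m]-th one all count as being among the first [m]. *)
Definition window (S : {set I}) : {set I} :=
  [set i in S | #|[set j in S | (key j < key i)%O]| < m].

Lemma window_sub S : window S \subset S.
Proof. by apply/subsetP=> i; rewrite inE => /andP[]. Qed.

Lemma window_del S p : window S :\ p \subset window (S :\ p).
Proof.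
apply/subsetP=> i; rewrite !inE => /and3P[-> -> /=].
apply: leq_ltn_trans; apply: subset_leq_card; apply/subsetP=> j.
by rewrite !inE => /andP[/andP[_ ->]].
Qed.

(** A least member of [S] outside the window would be preceded by window
    members only, hence by fewer than [m] members. *)
Lemma window_big (S : {set I}) : m <= #|S| -> m <= #|window S|.
Proof.
move=> mS; rewrite leqNgt; apply/negP => Wm.
have /subsetPn[i0 i0S i0W] : ~~ (S \subset window S).
  by apply/negP => /subset_leq_card/(leq_trans mS); rewrite leqNgt Wm.
have i0D : i0 \in S :\: window S by rewrite inE i0W.
case: (@arg_minP _ _ _ i0 [in S :\: window S] key i0D) => i.
rewrite !inE => /andP[iW iS] imin; move: iW; rewrite iS /= -leqNgt.
apply/negP; rewrite -ltnNge; apply: leq_ltn_trans Wm.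
apply: subset_leq_card; apply/subsetP=> j; rewrite inE => /andP[jS ji].
apply: contraTT ji => jW; rewrite -leNgt; apply: imin.
by rewrite inE jW jS.
Qed.

(** A member beyond [z] is preceded by all the members up to [z], too many for
    it to be in the window. *)
Lemma window_halfline (S : {set I}) z : m <= #|[set i in S | (key i <= z)%O]| ->
  {in window S, forall i, (key i <= z)%O}.
Proof.
move=> mS i; rewrite inE => /andP[iS]; apply: contraTT.
rewrite -ltNge -leqNgt => zi; apply: leq_trans mS _.
apply: subset_leq_card; apply/subsetP=> j; rewrite !inE => /andP[-> jz] /=.
exact: le_lt_trans zi.
Qed.

End Window.

(** Windows of [#|D| * k] members are just large enough for the [#|D| * k] pairs
    (order, colour) to reserve distinct members. *)
Theorem polychromatic_halflines (disp disp' : Order.disp_t)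
    (V : orderType disp) (V' : orderType disp') (I D : finType)
    (key : D -> I -> V) (h : I -> V') (k : nat) :
    0 < k ->
  exists c : I -> 'I_k, forall (d : D) (z : V) (y : V'),
    #|D| * k <= #|[set i | (key d i <= z)%O && (y <= h i)%O]| ->
    forall a : 'I_k, exists i, [/\ c i = a, (key d i <= z)%O & (y <= h i)%O].
Proof.
move=> k_gt0; have [d0 _|noD] := pickP (@predT D); last first.
  by exists (fun=> Ordinal k_gt0) => d; have := noD d.
have cardJ : #|{: D * 'I_k}| = (#|D| * k)%N by rewrite card_prod card_ord.
pose W (j : D * 'I_k) := window (key j.1) #|{: D * 'I_k}|.
have [||| g gW] := @slot_assignment _ _ I _ h W _ _ _ (d0, Ordinal k_gt0).
- by move=> j S; exact: window_sub.
- by move=> j S; exact: window_big.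
- by move=> j S p; exact: window_del.
exists (fun i => (g i).2) => d z y big a.
set S := superlevel h [set: I] y in gW.
have bigS : #|D| * k <= #|[set i in S | (key d i <= z)%O]|.
  apply: leq_trans big _; apply: subset_leq_card; apply/subsetP=> i.
  by rewrite !inE /= andbC.
have [|i gi iW] := gW y _ (d, a).
  rewrite cardJ; apply: leq_trans bigS _; apply: subset_leq_card.
  by apply/subsetP=> i; rewrite inE => /andP[].
exists i; split; first by rewrite gi.
  by apply: (window_halfline _ iW); rewrite cardJ.
by have := subsetP (window_sub _ _ _) _ iW; rewrite !inE.
Qed.

(** * Intersecting bottomless rectangles *)

Local Open Scope classical_set_scope.
Local Open Scope ring_scope.

Section Rectangles.
Variables (R : realType) (I : finType) (l r t : I -> R).

Definition side_key (left : bool) (i : I) : R := if left then l i else - r i.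

(** If [x < l j], a rectangle whose left side is at most [x] is not the [j]-th
    one, so it meets the [j]-th one and extends to the right as far as [l j]. *)
Lemma cover_halfline (p : R * R) :
    intersecting (fun i => bottomless_rectangle (l i) (r i) (t i)) ->
  exists left z, forall i,
    bottomless_rectangle (l i) (r i) (t i) p <->
    side_key left i <= z /\ p.2 <= t i.
Proof.
move=> F_int; case: p => x y.
have [/forallP lx|/forallPn[j]] := boolP [forall i, l i <= x].
  exists false, (- x) => i; rewrite /bottomless_rectangle /= lerN2 lx /=.
  by split=> -[].
rewrite -ltNge => xj; exists true, x => i; rewrite /bottomless_rectangle /=.
split=> [[/andP[-> _] ->]//|[lx ->]]; rewrite lx /=; split=> //.
have ij : i != j by apply: contraTneq lx => ->; rewrite -ltNge.
have [q [[/= /andP[_ qr] _] [/= /andP[lq _] _]]] := F_int i j ij.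
exact: le_trans (ltW xj) (le_trans lq qr).
Qed.

End Rectangles.

Lemma intersecting_colourable (R : realType) (k : nat) : (0 < k)%N ->
  colourable_from (@intersecting_bottomless R) k (2 * k).
Proof.
move=> k_gt0 I F [F_rect F_int].
have /choice[q Fq] : forall i, exists q : R * R * R,
    F i = bottomless_rectangle q.1.1 q.1.2 q.2.
  by move=> i; have [l [r [t ->]]] := F_rect i; exists (l, r, t).
pose l i := (q i).1.1; pose r i := (q i).1.2; pose t i := (q i).2.
have {Fq F_rect} FE : F = fun i => bottomless_rectangle (l i) (r i) (t i).
  exact/funext.
subst F.
have [c cP] := polychromatic_halflines (side_key l r) t k_gt0.
rewrite card_bool in cP; exists c => p.
have [left [z pP]] := cover_halfline p F_int.
rewrite /cover_number => big a.
have [|i [ci iz it]] := cP left z p.2 _ a.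
  apply: leq_trans big _; apply: subset_leq_card; apply/subsetP=> i.
  by rewrite !inE => /set_mem/pP[-> ->].
by exists i => //; apply/pP.
Qed.

Theorem theorem2p9 (R : realType) (k : nat) (hk : (0 < k)%N) :
  (exists2 m : nat, is_mstar (@intersecting_bottomless R) k m & (m <= 3 * k)%N) /\
  (forall (I : finType) (F : I -> set (R * R)),
     (forall i : I, is_bottomless_rectangle (F i)) ->
     intersecting F ->
     exists c : I -> 'I_k,
       forall p : R * R, (3 * k <= cover_number F p)%N ->
       forall a : 'I_k, exists2 i : I, c i = a & F i p).
Proof.
have col3 : colourable_from (@intersecting_bottomless R) k (3 * k).
  move=> I F /(intersecting_colourable hk)[c cP]; exists c => p big.
  by apply: cP; apply: leq_trans big; rewrite leq_mul2r orbT.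
split; last by move=> I F F_rect F_int; exact: col3.
pose colb m := `[< colourable_from (@intersecting_bottomless R) k m >].
have colb3 : exists m, colb m by exists (3 * k)%N; apply/asboolP.
exists (ex_minn colb3); case: ex_minnP => m /asboolP colm min_m.
  by split=> // m' /asboolP; exact: min_m.
by apply: min_m; apply/asboolP.
Qed.
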